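(* Suppose that $R$ is a local Noetherian domain whose maximal ideal $\mathfrak{m}$ is nonzero and principal. Then $R$ is a discrete valuation ring (DVR). Conversely, every DVR is a local Noetherian domain with a nonzero principal maximal ideal.
   Context: All rings are commutative with unity; a local ring is a ring with exactly one maximal ideal; a Noetherian domain is an integral domain that is Noetherian. A discrete valuation of a field $K$ is a surjective group homomorphism $v\colon K^\times \to \mathbb{Z}$ (from the multiplicative group of $K$ to the additive group $\mathbb{Z}$) such that $v(x+y)\ge \min\{v(x),v(y)\}$ for all $x,y\in K^\times$ with $x+y\neq 0$; by convention $v(0)=\infty$. A discrete valuation ring (DVR) is any ring of the form $\mathcal{O}_v=\{x\in K \mid v(x)\ge 0\}$, where $K$ is a field and $v$ is a discrete valuation of $K$. *)

(* Defs.v *)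
From HB Require Import structures.
From mathcomp Require Import all_boot all_order all_algebra.
From mathcomp Require Import boolp classical_sets.

Set Implicit Arguments.
Unset Strict Implicit.
Unset Printing Implicit Defensive.

Import Order.TTheory GRing.Theory Num.Theory.
Local Open Scope classical_set_scope.
Local Open Scope ring_scope.

Definition is_domain (R : comPzRingType) : Prop :=
  (1 : R) <> 0 /\ forall x y : R, x * y = 0 -> x = 0 \/ y = 0.

(* Ideals are Prop-valued and possibly improper, unlike the library's
   [idealr_closed], which concerns boolean predicates and excludes 1. *)
Definition is_ideal (R : comPzRingType) (I : set R) : Prop :=
  [/\ I 0,
      forall x y : R, I x -> I y -> I (x + y)
    & forall a x : R, I x -> I (a * x)].

Definition is_maximal_ideal (R : comPzRingType) (m : set R) : Prop :=
  [/\ is_ideal m,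
      m <> [set: R]
    & forall J : set R, is_ideal J -> m `<=` J -> J = m \/ J = [set: R]].

Definition is_local (R : comPzRingType) : Prop :=
  exists! m : set R, is_maximal_ideal m.

Definition ideal_generated (R : comPzRingType) (n : nat) (g : 'I_n -> R) :
    set R :=
  [set x : R | exists c : 'I_n -> R, x = \sum_(i < n) c i * g i].

Definition is_noetherian (R : comPzRingType) : Prop :=
  forall I : set R, is_ideal I ->
    exists (n : nat) (g : 'I_n -> R), I = ideal_generated g.

Definition is_principal (R : comPzRingType) (I : set R) : Prop :=
  exists a : R, I = [set x : R | exists c : R, x = c * a].

(* A map v : K^* -> Z is represented by a total function on K whose value at 0
   is never used. *)
Definition is_discrete_valuation (K : fieldType) (v : K -> int) : Prop :=
  [/\ forall x y : K, x != 0 -> y != 0 -> v (x * y) = v x + v y,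
      forall n : int, exists2 x : K, x != 0 & v x = n
    & forall x y : K, x != 0 -> y != 0 -> x + y != 0 ->
        Num.min (v x) (v y) <= v (x + y)].

(* The disjunct x = 0 is the convention v(0) = oo. *)
Definition valuation_ring (K : fieldType) (v : K -> int) : set K :=
  [set x : K | x = 0 \/ 0 <= v x].

(* R is isomorphic, as a ring, to the subring [valuation_ring v] of K: f is an
   injective ring morphism with that image. *)
Definition is_DVR (R : comPzRingType) : Prop :=
  exists (K : fieldType) (v : K -> int) (f : {rmorphism R -> K}),
    [/\ is_discrete_valuation v, injective f & range f = valuation_ring v].

(* Main.v *)
Require Import Defs.
From HB Require Import structures.
From mathcomp Require Import all_boot all_order all_algebra.
From mathcomp Require Import boolp classical_sets.

Set Implicit Arguments.
Unset Strict Implicit.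
Unset Printing Implicit Defensive.

Import Order.TTheory GRing.Theory Num.Theory.
Local Open Scope classical_set_scope.
Local Open Scope ring_scope.

(** For a domain, both properties are equivalent to the existence of a
    uniformizer: a nonzero nonunit t such that every nonzero element is a unit
    times a power of t.

    Local Noetherian domain to uniformizer.  Let t generate the maximal ideal.
    By Zorn's lemma every nonunit lies in a maximal ideal, hence is a multiple
    of t.  So a nonzero x can be divided by t again and again until the quotient
    is a unit, provided that this stops
    ([noetherian_not_infinitely_divisible]).  It does: the y such that some
    t^n y lies in (x) form an ideal; it is finitely generated, so a single
    exponent N works for all of it; and if x = c t^(N+1), then t^N c is in (x),
    that is t^N c = a x = a t (t^N c), which makes t a unit.

    Uniformizer to DVR.  Every nonzero element of the fraction field is
    uniquely u t^n with u a unit of R and n an integer, and sending it to n is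
    a discrete valuation whose valuation ring is R.

    DVR to uniformizer.  An element t of valuation 1 works: if x has valuation
    n, then x / t^n has valuation 0, hence is a unit of the valuation ring.

    Uniformizer to local Noetherian domain.  Every nonzero ideal is generated
    by the smallest power of t that it contains, and every proper ideal is
    contained in (t), which is therefore the only maximal ideal. *)

(** * Ideals and maximal ideals *)

Definition is_unit (R : comPzRingType) (u : R) : Prop := exists w, w * u = 1.

Definition principal_ideal (R : comPzRingType) (a : R) : set R :=
  [set x : R | exists c : R, x = c * a].

Lemma principal_ideal_is_ideal (R : comPzRingType) (a : R) :
  is_ideal (principal_ideal a).
Proof.
split=> [|_ _ [c ->] [d ->]|b _ [c ->]].
- by exists 0; rewrite mul0r.
- by exists (c + d); rewrite mulrDl.
- by exists (b * c); rewrite mulrA.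
Qed.

Lemma ideal_sum (R : comPzRingType) (I : set R) (n : nat) (F : 'I_n -> R) :
  is_ideal I -> (forall i, I (F i)) -> I (\sum_(i < n) F i).
Proof.
by case=> I0 ID _ IF; apply: (big_ind I) => // i _; exact: IF.
Qed.

Lemma ideal_generated_mem (R : comPzRingType) n (g : 'I_n -> R) i :
  ideal_generated g (g i).
Proof.
exists (fun j => (j == i)%:R).
rewrite (bigD1 i) //= eqxx mul1r big1 ?addr0 // => j /negbTE ->.
by rewrite mul0r.
Qed.

Lemma ideal_generated1 (R : comPzRingType) (a : R) :
  ideal_generated (fun _ : 'I_1 => a) = principal_ideal a.
Proof.
apply/seteqP; split=> x [c ->]; first by exists (c ord0); rewrite big_ord1.
by exists (fun=> c); rewrite big_ord1.
Qed.

Lemma ideal_one (R : comPzRingType) (I : set R) :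
  is_ideal I -> I 1 -> I = [set: R].
Proof.
case=> _ _ IM I1; apply/seteqP; split=> x //= _.
by rewrite -[x]mulr1; apply: IM.
Qed.

Lemma maximal_ideal_one (R : comPzRingType) (m : set R) :
  is_maximal_ideal m -> ~ m 1.
Proof. by case=> mI mT _ /(ideal_one mI). Qed.

(** Zorn's lemma, applied to the proper ideals containing I. *)
Lemma proper_ideal_sub_maximal (R : comPzRingType) (I : set R) :
  is_ideal I -> ~ I 1 -> exists2 m, is_maximal_ideal m & I `<=` m.
Proof.
move=> II I1.
(* The empty set is admitted because it is the union of the empty chain. *)
pose P (A : set R) := A = set0 \/ [/\ is_ideal A, I `<=` A & ~ A 1].
have [F FP Ftot|A [PA Amax]] := @Zorn_bigcup R P.
  have [[A FA A0]|F0] := pselect (exists2 A, F A & A <> set0); last first.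
    left; apply/seteqP; split=> // x [A FA Ax]; apply: F0; exists A => //.
    by move=> A0; rewrite A0 in Ax.
  have FI B x : F B -> B x -> [/\ is_ideal B, I `<=` B & ~ B 1].
    by move=> FB Bx; case: (FP _ FB) => // B0; rewrite B0 in Bx.
  have [x Ax] : A !=set0 by apply/set0P/eqP.
  have [[A_0 _ _] IA _] := FI _ _ FA Ax.
  right; split; last by move=> [B FB B1]; have [_ _] := FI _ _ FB B1.
    split; first by exists A.
      move=> y z [B FB By] [C FC Cz].
      have [[_ BD _] _ _] := FI _ _ FB By; have [[_ CD _] _ _] := FI _ _ FC Cz.
      have [BC|CB] := Ftot _ _ FB FC.
        by exists C => //; apply: CD => //; exact: BC.
      by exists B => //; apply: BD => //; exact: CB.
    move=> a y [B FB By]; exists B => //.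
    by have [[_ _ BM] _ _] := FI _ _ FB By; apply: BM.
  by move=> y /IA Ay; exists A.
have [AI IA A1] : [/\ is_ideal A, I `<=` A & ~ A 1].
  case: PA => // A0; exfalso; apply: (Amax I); last by right; split.
  by rewrite A0; case: II => I0 _ _; split=> // /(_ 0 I0).
exists A => //; split=> // [AT|J JI AJ]; first by apply: A1; rewrite AT.
have [J1|J1] := pselect (J 1); first by right; exact: ideal_one.
left; apply/seteqP; split=> //; apply: contrapT => JA.
by apply: (Amax J) => //; right; split=> //; exact: subset_trans AJ.
Qed.

(** * The field of fractions of a domain given by axioms *)

Lemma domain_mulIr (R : comPzRingType) (x y z : R) :
  is_domain R -> z <> 0 -> x * z = y * z -> x = y.
Proof.
case=> _ dom z0 /eqP; rewrite -subr_eq0 -mulrBl => /eqP /dom [/eqP|//].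
by rewrite subr_eq0 => /eqP.
Qed.

(** Stated on a [comPzRingType], so that it can be moved along a conversion from
    an [idomainType] to the bare ring on which it is built. *)
Definition has_fraction_field (R : comPzRingType) : Prop :=
  exists (K : fieldType) (f : {rmorphism R -> K}),
    injective f /\ forall z : K, exists a b : R, f b != 0 /\ z = f a / f b.

Lemma pi_fraction (D : idomainType) (r : {ratio D}) :
  \pi_{fraction D}%qT r = FracField.tofrac \n_r / FracField.tofrac \d_r.
Proof.
apply: (canRL (mulfK _)); first by rewrite tofrac_eq0 denom_ratioP.
unlock FracField.tofrac; rewrite -[LHS]FracField.pi_mul; apply/eqP.
rewrite FracField.equivf_def /FracField.mulf.
by rewrite !numden_Ratio ?mulr1 ?mul1r ?oner_neq0 ?denom_ratioP // mulrC.
Qed.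

Lemma idomain_has_fraction_field (D : idomainType) : has_fraction_field D.
Proof.
exists {fraction D}, (@FracField.tofrac D); split.
  by move=> x y /eqP; rewrite tofrac_eq => /eqP.
elim/quotW=> r; exists \n_r, \d_r.
split; first by rewrite tofrac_eq0 denom_ratioP.
exact: pi_fraction.
Qed.

(** Excluded middle decides invertibility and choice provides an inverse, so the
    bare ring underlies an [idomainType], whose fraction field is available. *)
Lemma domain_has_fraction_field (R : comPzRingType) :
  is_domain R -> has_fraction_field R.
Proof.
move=> [oneN0 integral].
pose unit : {pred R} := fun x => `[< is_unit x >].
pose inv (x : R) : R :=
  if pselect (is_unit x) is left ux then sval (cid ux) else x.
have one_neq0 : (1 : R) != 0 by apply/eqP.
pose D1 : comNzRingType :=
  HB.pack (GRing.ComPzRing.sort R)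
    (GRing.PzSemiRing_isNonZero.Build R one_neq0).
have mulVx : {in unit, left_inverse 1 inv (@GRing.mul D1)}.
  move=> x /asboolP ux; rewrite /inv; case: pselect => // ux'.
  by case: (cid ux').
have unitPl (x y : D1) : y * x = 1 -> unit x.
  by move=> yx; apply/asboolP; exists y.
have invr_out : {in [predC unit], inv =1 id}.
  by move=> x /asboolP Nux; rewrite /inv; case: pselect.
pose D2 : comUnitRingType := HB.pack (GRing.ComPzRing.sort R) D1
  (GRing.ComNzRing_hasMulInverse.Build D1 mulVx unitPl invr_out).
have integral' (x y : D2) : x * y = 0 -> (x == 0) || (y == 0).
  by move=> /integral [] ->; rewrite eqxx ?orbT.
pose D : idomainType := HB.pack (GRing.ComPzRing.sort R) D2
  (GRing.ComUnitRing_isIntegral.Build D2 integral').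
(* Forgetting the added structure of D gives back R up to conversion. *)
exact: (idomain_has_fraction_field D).
Qed.

(** * Uniformizers and local Noetherian domains *)

Definition is_uniformizer (R : comPzRingType) (t : R) : Prop :=
  [/\ t <> 0, ~ is_unit t
    & forall x : R, x <> 0 ->
        exists (u : R) (n : nat), is_unit u /\ x = u * t ^+ n].

Lemma is_unitM (R : comPzRingType) (u w : R) :
  is_unit u -> is_unit w -> is_unit (u * w).
Proof.
by move=> [a au] [b bw]; exists (a * b); rewrite mulrACA au bw mulr1.
Qed.

(** This is Krull's intersection theorem for (t). The ideal of all y with
    t^n y in (x) for some n is the increasing union of the ideals obtained for
    each n, so by finite generation it is reached at some N; then
    x = c t^(N+1) forces t^N c in (x), and cancelling t^N c inverts t. *)
Lemma noetherian_not_infinitely_divisible (R : comPzRingType) (t x : R) :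
  is_noetherian R -> is_domain R -> ~ is_unit t -> x <> 0 ->
  exists n : nat, ~ principal_ideal (t ^+ n) x.
Proof.
move=> noeth dom tNu x0; apply: contrapT => /forallNP tdvd.
have {}tdvd n : principal_ideal (t ^+ n) x by apply: contrapT; exact: tdvd.
pose sat n := [set y : R | principal_ideal x (t ^+ n * y)].
have satI n : is_ideal (sat n).
  have [x_0 xD xM] := principal_ideal_is_ideal x.
  split=> [|y z Sy Sz|a y Sy]; rewrite /sat /= ?mulr0 // ?mulrDr.
    exact: xD.
  by rewrite mulrCA; exact: xM.
have satS n k : (n <= k)%N -> sat n `<=` sat k.
  move=> /subnK <- y; rewrite /sat /= exprD -mulrA.
  by have [_ _ xM] := principal_ideal_is_ideal x; exact: xM.
have satT : is_ideal (\bigcup_n sat n).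
  split; first by exists 0%N => //; have [] := satI 0%N.
    move=> y z [n _ ny] [k _ kz]; exists (maxn n k) => //.
    have [_ nkD _] := satI (maxn n k).
    apply: nkD; [apply: satS ny; exact: leq_maxl|].
    by apply: satS kz; exact: leq_maxr.
  by move=> a y [n _ ny]; exists n => //; have [_ _ nM] := satI n; exact: nM.
have [r [g gE]] := noeth _ satT.
have /choice [e eP] i : exists n, sat n (g i).
  by have := ideal_generated_mem g i; rewrite -gE => -[n _]; exists n.
pose N := \max_(i < r) e i.
have satN : \bigcup_n sat n `<=` sat N.
  rewrite gE => y [c ->]; apply: ideal_sum => // i.
  have [_ _ NM] := satI N; apply: NM; apply: satS (eP i).
  exact: leq_bigmax.
(* The quotient c of x by t^(N+1) is in the union, hence already in sat N. *)
have [c xE] := tdvd N.+1.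
have [a aE] : sat N c.
  by apply: satN; exists N.+1 => //; exists 1; rewrite mul1r mulrC.
apply: tNu; exists a.
have xE' : x = t * (t ^+ N * c) by rewrite mulrA -exprS mulrC.
have y0 : t ^+ N * c <> 0 by move=> y0; apply: x0; rewrite xE' y0 mulr0.
by apply: (domain_mulIr dom y0); rewrite mul1r -mulrA -xE' aE.
Qed.

(** Divide x by the largest power of t possible: the quotient is not a multiple
    of t, hence is a unit. *)
Lemma uniformizer_of_principal_maximal (R : comPzRingType) (t : R) :
  is_noetherian R -> is_domain R -> t <> 0 -> ~ is_unit t ->
  (forall x : R, ~ is_unit x -> principal_ideal t x) -> is_uniformizer t.
Proof.
move=> noeth dom t0 tNu tdvd; split=> // x x0.
have [n nP] := noetherian_not_infinitely_divisible noeth dom tNu x0.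
have ex : exists n, ~~ `[< principal_ideal (t ^+ n) x >].
  by exists n; apply/asboolPn.
case: (ex_minnP ex) => -[|k] /asboolPn kP kmin.
  by case: kP; exists x; rewrite mulr1.
have [c xE] : principal_ideal (t ^+ k) x.
  by apply: contrapT => /asboolPn /kmin; rewrite ltnn.
exists c, k; split=> //; apply: contrapT => /tdvd [d cE]; apply: kP.
by exists d; rewrite xE cE exprS mulrA.
Qed.

Lemma local_noetherian_uniformizer (R : comPzRingType) :
  is_local R -> is_noetherian R -> is_domain R ->
  (forall m : set R, is_maximal_ideal m -> m <> [set 0] /\ is_principal m) ->
  exists t : R, is_uniformizer t.
Proof.
move=> [m [mmax muniq]] noeth dom /(_ m mmax) [m0 [t mE]]; exists t.
have mt : m t by rewrite mE; exists 1; rewrite mul1r.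
have m1 := maximal_ideal_one mmax.
apply: uniformizer_of_principal_maximal => //.
- move=> t0; apply: m0; rewrite mE t0; apply/seteqP; split=> x.
    by move=> [c ->]; rewrite mulr0.
  by move=> ->; exists 0; rewrite mul0r.
- by move=> [w wt]; apply: m1; rewrite mE; exists w.
- move=> x xNu; rewrite /principal_ideal -mE.
  have [||M Mmax xM] := @proper_ideal_sub_maximal R (principal_ideal x).
  + exact: principal_ideal_is_ideal.
  + by move=> [w w1]; apply: xNu; exists w.
  + by rewrite (muniq M Mmax); apply: xM; exists 1; rewrite mul1r.
Qed.

(** A nonzero ideal is generated by the smallest power of t that it contains,
    because an element u t^k with u a unit generates the same ideal as t^k. *)
Lemma uniformizer_ideal (R : comPzRingType) (t : R) (I : set R) :
  is_uniformizer t -> is_ideal I -> exists a, I = principal_ideal a.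
Proof.
move=> [_ _ tfact] II; have [I0 _ IM] := II.
have [[x Ix x0]|Itriv] := pselect (exists2 x, I x & x <> 0); last first.
  exists 0; apply/seteqP; split=> x; last by move=> [c ->]; rewrite mulr0.
  move=> Ix; exists 0; rewrite mul0r; apply: contrapT => x0.
  by apply: Itriv; exists x.
have Ipow u k : is_unit u -> I (u * t ^+ k) -> I (t ^+ k).
  by move=> [w wu] /(IM w); rewrite mulrA wu mul1r.
have ex : exists n, `[< I (t ^+ n) >].
  have [u [k [uu xE]]] := tfact x x0; exists k; apply/asboolP.
  by apply: Ipow uu _; rewrite -xE.
case: (ex_minnP ex) => n /asboolP nI nmin; exists (t ^+ n).
apply/seteqP; split=> y; last by move=> [c ->]; exact: IM.
move=> Iy; have [->|/eqP y0] := eqVneq y 0; first by exists 0; rewrite mul0r.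
have [u [k [uu yE]]] := tfact y y0.
have nk : (n <= k)%N.
  by apply: nmin; apply/asboolP; apply: Ipow uu _; rewrite -yE.
by exists (u * t ^+ (k - n)); rewrite yE -mulrA -exprD subnK.
Qed.

(** An element outside (t) is a unit, so (t) contains every proper ideal. *)
Lemma uniformizer_maximal (R : comPzRingType) (t : R) (m : set R) :
  is_uniformizer t -> (is_maximal_ideal m <-> m = principal_ideal t).
Proof.
move=> [_ tNu tfact].
have tI := principal_ideal_is_ideal t.
have t1 : ~ principal_ideal t 1 by move=> [w w1]; apply: tNu; exists w.
have proper_sub J : is_ideal J -> ~ J 1 -> J `<=` principal_ideal t.
  move=> [_ _ JM] J1 x Jx.
  have [->|/eqP x0] := eqVneq x 0; first by exists 0; rewrite mul0r.
  have [u [[|n] [[w wu] xE]]] := tfact x x0.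
    by case: J1; rewrite -wu -[u]mulr1 -xE; exact: JM.
  by exists (u * t ^+ n); rewrite xE exprSr mulrA.
split=> [mmax|->].
  have m1 := maximal_ideal_one mmax; have [mI _ /(_ _ tI)] := mmax.
  case; [exact: proper_sub|by []|].
  by move=> tT; case: t1; rewrite tT.
split=> // [tT|J JI tJ]; first by apply: t1; rewrite tT.
have [J1|J1] := pselect (J 1); first by right; exact: ideal_one.
by left; apply/seteqP; split=> //; exact: proper_sub.
Qed.

(** * Uniformizers and discrete valuations *)

Lemma valuation1 (K : fieldType) (v : K -> int) :
  is_discrete_valuation v -> v 1 = 0.
Proof.
move=> [vM _ _]; apply/(addIr (v 1)).
by rewrite add0r -vM ?mulr1 ?oner_neq0.
Qed.

Lemma valuationV (K : fieldType) (v : K -> int) (x : K) :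
  is_discrete_valuation v -> x != 0 -> v x^-1 = - v x.
Proof.
move=> vP x0; have [vM _ _] := vP; apply/eqP.
rewrite -addr_eq0 -vM ?invr_neq0 //.
by rewrite mulVf // (valuation1 vP).
Qed.

Lemma valuationX (K : fieldType) (v : K -> int) (x : K) (n : nat) :
  is_discrete_valuation v -> x != 0 -> v (x ^+ n) = v x *+ n.
Proof.
move=> vP x0; have [vM _ _] := vP.
elim: n => [|n IHn]; first by rewrite expr0 (valuation1 vP).
by rewrite exprS vM ?expf_neq0 // IHn mulrS.
Qed.

Lemma DVR_domain (R : comPzRingType) : is_DVR R -> is_domain R.
Proof.
move=> [K [v [f [_ finj _]]]]; split=> [|x y xy0].
  by move/(congr1 f)/eqP; rewrite rmorph1 rmorph0 oner_eq0.
have /eqP : f x * f y = 0 by rewrite -rmorphM xy0 rmorph0.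
by rewrite mulf_eq0 => /orP[] /eqP fx0;
  [left|right]; apply: finj; rewrite fx0 rmorph0.
Qed.

(** Any t of valuation 1 works: if x has valuation n, then x / t^n and its
    inverse have valuation 0, so both lie in the valuation ring. *)
Lemma DVR_uniformizer (R : comPzRingType) :
  is_DVR R -> exists t : R, is_uniformizer t.
Proof.
move=> [K [v [f [vP finj frange]]]]; have [vM vsurj _] := vP.
have lift z : 0 <= v z -> exists x, f x = z.
  move=> z0; have : valuation_ring v z by right.
  by rewrite -frange => -[x _ <-]; exists x.
have f_neq0 x : x <> 0 -> f x != 0.
  by move=> x0; apply/eqP => fx0; apply: x0; apply: finj; rewrite fx0 rmorph0.
have v_ge0 x : x <> 0 -> 0 <= v (f x).
  move=> /f_neq0 fx0; have : range f (f x) by exists x.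
  by rewrite frange => -[fx|//]; rewrite fx eqxx in fx0.
have [p p0 vp] := vsurj 1.
have [t tp] : exists t, f t = p by apply: lift; rewrite vp.
exists t; split=> [t0|[w wt]|x x0].
- by move: p0; rewrite -tp t0 rmorph0 eqxx.
- have w0 : w <> 0.
    move=> w0; have /eqP := congr1 f wt.
    by rewrite w0 mul0r rmorph0 rmorph1 eq_sym oner_eq0.
  have := congr1 (v \o f) wt; rewrite /= rmorphM rmorph1 (valuation1 vP) tp.
  rewrite vM ?f_neq0 // vp => vw; have := v_ge0 w w0.
  by move/eqP: vw; rewrite addr_eq0 => /eqP ->.
- have fx0 := f_neq0 x x0; have := v_ge0 x x0.
  case vx : (v (f x)) => [n|//] _.
  have pn0 : p ^+ n != 0 by rewrite expf_neq0.
  have vpn : v (p ^+ n) = n by rewrite (valuationX _ vP) // vp natz.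
  have [u uE] : exists u, f u = f x / p ^+ n.
    by apply: lift; rewrite vM ?invr_neq0 // (valuationV vP) // vx vpn subrr.
  have [w wE] : exists w, f w = p ^+ n / f x.
    by apply: lift; rewrite vM ?invr_neq0 // (valuationV vP) // vx vpn subrr.
  exists u, n; split; first exists w; apply: finj; rewrite rmorphM.
    by rewrite uE wE rmorph1 mulrA divfK // mulfV.
  by rewrite rmorphXn tp uE divfK.
Qed.

(** The valuation of z in the fraction field is the n such that z = u t^n with u
    a unit of R. It exists by factoring numerator and denominator; it is unique
    because 1 = u t^n with n nonzero would make t invertible. *)
Lemma uniformizer_DVR (R : comPzRingType) (t : R) :
  is_domain R -> is_uniformizer t -> is_DVR R.
Proof.
move=> dom [t0 tNu tfact].
have [K [f [finj fracP]]] := domain_has_fraction_field dom.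
have f_neq0 x : x <> 0 -> f x != 0.
  by move=> x0; apply/eqP => fx0; apply: x0; apply: finj; rewrite fx0 rmorph0.
have T0 := f_neq0 t t0.
have unit_neq0 u : is_unit u -> f u != 0.
  move=> [w wu]; apply/f_neq0 => u0; move: wu; rewrite u0 mulr0.
  by case: dom => one0 _ /esym /one0.
pose has_val (z : K) (n : int) := exists2 u, is_unit u & z = f u * f t ^ n.
have has_val_neq0 z n : has_val z n -> z != 0.
  by move=> [u uu ->]; apply: mulf_neq0; [exact: unit_neq0|exact: expfz_neq0].
have has_valM z w n k : has_val z n -> has_val w k -> has_val (z * w) (n + k).
  move=> [u uu ->] [u' uu' ->]; exists (u * u'); first exact: is_unitM.
  by rewrite rmorphM expfzDr // mulrACA.
have has_valV z n : has_val z n -> has_val z^-1 (- n).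
  move=> [u [w wu] ->]; exists w; first by exists u; rewrite mulrC.
  rewrite invfM invr_expz; congr (_ * _); apply: (mulIf (unit_neq0 u _)).
    by exists w.
  by rewrite mulVf ?unit_neq0 -?rmorphM ?wu ?rmorph1 //; exists w.
have has_val_nat x : x <> 0 -> exists n : nat, has_val (f x) n.
  move=> /tfact [u [n [uu ->]]]; exists n, u => //.
  by rewrite rmorphM rmorphXn.
have has_val_ex z : z != 0 -> exists n, has_val z n.
  have [a [b [b0 ->]]] := fracP z => ab0.
  have [|n an] := has_val_nat a.
    by move=> a0; rewrite a0 rmorph0 mul0r eqxx in ab0.
  have [|k bk] := has_val_nat b.
    by move=> b_0; rewrite b_0 rmorph0 eqxx in b0.
  by exists (n%:Z - k%:Z); apply: has_valM => //; exact: has_valV.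
(* For negative n, pass to the inverse of 1 = u t^n. *)
have has_val1 n : has_val 1 n -> n = 0.
  have pos k : ~ has_val 1 k.+1%:Z.
    move=> [u _ /esym uE]; apply: tNu; exists (u * t ^+ k).
    by apply: finj; rewrite -mulrA -exprSr rmorphM rmorphXn rmorph1.
  case: n => [[|k] //|k] => [/pos //|/has_valV]; rewrite invr1 NegzE opprK.
  by move/pos.
have has_val_uniq z n k : has_val z n -> has_val z k -> n = k.
  move=> zn zk; have z0 := has_val_neq0 _ _ zn.
  have := has_valM _ _ _ _ zn (has_valV _ _ zk); rewrite mulfV // => /has_val1.
  by move/eqP; rewrite subr_eq0 => /eqP.
pose v (z : K) : int :=
  if pselect (exists n, has_val z n) is left zn then sval (cid zn) else 0.
have vP z : z != 0 -> has_val z (v z).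
  move=> /has_val_ex zn; rewrite /v.
  by case: pselect => // zn'; case: (cid zn').
have vE z n : has_val z n -> v z = n.
  by move=> zn; apply: has_val_uniq (vP _ (has_val_neq0 _ _ zn)) zn.
have v_ge0 x : x <> 0 -> 0 <= v (f x).
  by move=> /has_val_nat [n /vE ->].
have integral z : 0 <= v z -> exists x, f x = z.
  have [->|/vP] := eqVneq z 0; first by exists 0; rewrite rmorph0.
  case: (v z) => // n [u _ ->] _; exists (u * t ^+ n).
  by rewrite rmorphM rmorphXn.
exists K, v, f; split=> //.
- split=> [x y x0 y0|n|x y x0 y0 xy0].
  + by apply: vE; apply: has_valM; exact: vP.
  + have tn : has_val (f t ^ n) n.
      by exists 1; [exists 1; rewrite mulr1|rewrite rmorph1 mul1r].
    by exists (f t ^ n); [exact: has_val_neq0 tn|exact: vE].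
  + wlog le_xy : x y x0 y0 xy0 / v x <= v y.
      move=> H; have [|yx] := orP (le_total (v x) (v y)); first exact: H.
      by rewrite addrC minC; apply: H yx => //; rewrite addrC.
    rewrite (min_idPl le_xy).
    (* As v x <= v y, y / x is the image of some s in R, and
       x + y = x (1 + s) with v (1 + s) >= 0. *)
    have xV := has_valV _ _ (vP x x0).
    have [s sE] : exists s, f s = y / x.
      apply: integral; rewrite (vE _ _ (has_valM _ _ _ _ (vP y y0) xV)).
      by rewrite subr_ge0.
    have xyE : x + y = x * f (1 + s).
      by rewrite rmorphD rmorph1 sE mulrDr mulr1 mulrCA mulfV // mulr1.
    have s0 : 1 + s <> 0 by move=> s0; rewrite xyE s0 rmorph0 mulr0 eqxx in xy0.
    rewrite xyE (vE _ _ (has_valM _ _ _ _ (vP x x0) (vP _ (f_neq0 _ s0)))).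
    by rewrite lerDl v_ge0.
- apply/seteqP; split=> z.
    move=> [x _ <-]; have [->|/eqP x0] := eqVneq x 0.
      by left; rewrite rmorph0.
    by right; exact: v_ge0.
  case=> [->|/integral [x <-]]; last by exists x.
  by exists 0; rewrite ?rmorph0.
Qed.

Theorem theorem11 (R : comPzRingType) :
  ([/\ is_local R, is_noetherian R, is_domain R
     & forall m : set R, is_maximal_ideal m ->
         m <> [set 0] /\ is_principal m] ->
   is_DVR R) /\
  (is_DVR R ->
   [/\ is_local R, is_noetherian R, is_domain R
     & forall m : set R, is_maximal_ideal m ->
         m <> [set 0] /\ is_principal m]).
Proof.
split=> [[Rloc noeth dom mprinc]|dvr].
  have [t tunif] := local_noetherian_uniformizer Rloc noeth dom mprinc.
  exact: uniformizer_DVR tunif.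
have [t tunif] := DVR_uniformizer dvr; have maxE := uniformizer_maximal _ tunif.
split.
- exists (principal_ideal t); split; first exact/maxE.
  by move=> m /maxE.
- move=> I /(uniformizer_ideal tunif) [a ->].
  by exists 1%N, (fun=> a); rewrite ideal_generated1.
- exact: DVR_domain.
- move=> m /maxE ->; split; last by exists t.
  have [t0 _ _] := tunif => mE; apply: t0.
  have : principal_ideal t t by exists 1; rewrite mul1r.
  by rewrite mE.
Qed.
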